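(* Let $F$ be a distribution function on $\mathbb{R}$ with $F(x)<1$ for all $x$, and suppose that for some $x_0\ge 0$ one of the following two representations holds for all $x\ge x_0$: (i) $1-F(x)=c(x)\exp\left\{-\int_{x_0}^{x}\frac{1}{f(t)}\,dt\right\}$, or (ii) $1-F(x)=c(x)\exp\left\{-\int_{x_0}^{x}\frac{g(t)}{f(t)}\,dt\right\}$, where $f$ is positive and absolutely continuous on $[x_0,\infty)$ with density $f'$ satisfying $f'(x)\to 0$ as $x\to\infty$, $c(x)\to c>0$ as $x\to\infty$, and (in case (ii)) $g(x)\to 1$ as $x\to\infty$. Let $X_1,X_2,\dots$ be i.i.d. random variables with distribution function $F$ and $M_n=\max(X_1,\dots,X_n)$. Let $b_n=F^{\leftarrow}(1-n^{-1})$, and let $a_n=f(b_n)$ in case (i), $a_n=f(b_n)/g(b_n)$ in case (ii). Define, for $a_nx+b_n\ge x_0$, in case (i) $$\gamma_n(x)=\int_{b_n}^{a_nx+b_n}\left(\frac{1}{f(t)}-\frac{1}{f(b_n)}\right)dt-\log\frac{c(a_nx+b_n)}{c(b_n)}+x,$$ and in case (ii) $$\gamma_n(x)=\int_{b_n}^{a_nx+b_n}\left(\frac{g(t)}{f(t)}-\frac{g(b_n)}{f(b_n)}\right)dt-\log\frac{c(a_nx+b_n)}{c(b_n)}+x,$$ and let $$B_n(x)=\begin{cases}\exp\left(-e^{-\gamma_n(x)}\right), & \gamma_n(x)\ge-\log n,\\ 0, & \gamma_n(x)<-\log n.\end{cases}$$ Then $$P(M_n\le a_nx+b_n)-B_n(x)=O(1/n),\qquad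 n\to\infty,$$ uniformly in $x\in\mathbb{R}$. Moreover, for all $x$, $B_n(x)\to\Lambda(x)=\exp(-e^{-x})$ as $n\to\infty$.
   Context: $F^{\leftarrow}(y)=\inf\{x: F(x)\ge y\}$ is the generalized inverse. The numbers $b_n$ are taken to satisfy $1-F(b_n)=1/n$, i.e. $\int_{x_0}^{b_n}\frac{1}{f(t)}dt=\log(n\,c(b_n))$ in case (i) and $\int_{x_0}^{b_n}\frac{g(t)}{f(t)}dt=\log(n\,c(b_n))$ in case (ii). All quantities are considered for $n$ large enough that $b_n>x_0$ and $g(b_n)>0$. For $x$ with $a_nx+b_n<x_0$ (where $\gamma_n(x)$ is not defined by the representation) one sets $B_n(x)=0$. *)

(* Defs.v *)
From HB Require Import structures.
From mathcomp Require Import all_boot all_order all_algebra.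
From mathcomp Require Import all_classical all_reals all_analysis.

Set Implicit Arguments.
Unset Strict Implicit.
Unset Printing Implicit Defensive.

Import Order.TTheory GRing.Theory Num.Theory.
Import numFieldNormedType.Exports.

Local Open Scope classical_set_scope.
Local Open Scope ring_scope.

(* As [inf] is total on sets of reals, this is meaningful only for levels y at
   which the set is nonempty and bounded below; for a distribution function
   these include all 0 < y < 1. *)
Definition geninv (R : realType) (F : R -> R) (y : R) : R :=
  inf [set x | y <= F x].

(* A genuine quantile only for 2 <= n (see [geninv]). *)
Definition norm_b (R : realType) (F : R -> R) (n : nat) : R :=
  geninv F (1 - n%:R^-1).

(* Oriented integral, so that int_a^b = - int_b^a when b < a. *)
Definition oint (R : realType) (h : R -> R) (a b : R) : R :=
  if a <= b then \int[@lebesgue_measure R]_(t in `[a, b]) h t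
  else - \int[@lebesgue_measure R]_(t in `[b, a]) h t.

Definition integrable_on_segments (R : realType) (x0 : R) (h : R -> R) : Prop :=
  forall x : R, x0 <= x ->
    (@lebesgue_measure R).-integrable `[x0, x] (EFin \o h).

(* Absolute continuity on every [x0, x], in the form of the indefinite Lebesgue
   integral of the density f'. *)
Definition abs_cont_density (R : realType) (x0 : R) (f f' : R -> R) : Prop :=
  integrable_on_segments x0 f' /\
  forall x : R, x0 <= x -> f x = f x0 + oint f' x0 x.

Definition tail_repr (R : realType) (F : R -> R) (x0 : R) (c h : R -> R) : Prop :=
  forall x : R, x0 <= x -> 1 - F x = c x * expR (- oint h x0 x).

(* Both representations share this form: h is 1 / f or g / f, hence h b is
   1 / f b or g b / f b, and a = (h b)^-1 in the intended use. *)
Definition gamma_ (R : realType) (c h : R -> R) (a b x : R) : R :=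
  oint (fun t => h t - h b) b (a * x + b) - ln (c (a * x + b) / c b) + x.

Definition B_ (R : realType) (x0 : R) (c h : R -> R) (a b : R) (n : nat)
    (x : R) : R :=
  if a * x + b < x0 then 0
  else if - ln n%:R <= gamma_ c h a b x
       then expR (- expR (- gamma_ c h a b x))
       else 0.

Definition Gumbel (R : realType) (x : R) : R := expR (- expR (- x)).

Definition mutually_independent (d : measure_display) (T : measurableType d)
    (R : realType) (P : probability T R) (X : nat -> {RV P >-> R}) : Prop :=
  forall (s : seq nat) (A : nat -> set R), uniq s ->
    (forall i, i \in s -> measurable (A i)) ->
    P (\bigcap_(i in [set` s]) (X i @^-1` A i)) =
      (\prod_(i <- s) P (X i @^-1` A i))%E.

(* For 1 <= n, the maximum of X 0, ..., X n.-1, i.e. of the first n variables: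
   the sequence is indexed from 0, and the initial value X 0 of the fold is one
   of the variables. *)
Definition sample_max (d : measure_display) (T : measurableType d)
    (R : realType) (P : probability T R) (X : nat -> {RV P >-> R}) (n : nat)
    (w : T) : R :=
  \big[Num.max/X 0%N w]_(i < n) X i w.

Definition prob_max_le (d : measure_display) (T : measurableType d)
    (R : realType) (P : probability T R) (X : nat -> {RV P >-> R}) (n : nat)
    (y : R) : R :=
  fine (P [set w | sample_max X n w <= y]).

(* Main.v *)
Require Import Defs.
From HB Require Import structures.
From mathcomp Require Import all_boot all_order all_algebra.
From mathcomp Require Import all_classical all_reals all_analysis.
From mathcomp Require Import ring lra.

Import Order.TTheory GRing.Theory Num.Theory.
Import numFieldNormedType.Exports.

Local Open Scope classical_set_scope.
Local Open Scope ring_scope.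

Set Implicit Arguments.
Unset Strict Implicit.
Unset Printing Implicit Defensive.

(** Write [h] for [1 / f] or [g / f], so that [h (b_n) * a_n = 1] and
[1 - F (b_n) = 1 / n].  The function [gamma_n] is nothing but a logarithmic
change of scale for the tail: for [y = a_n x + b_n >= x0], dividing the
representation at [y] by the representation at [b_n] gives
[exp (- gamma_n x) = n (1 - F y)] exactly ([tail_reprE]).

Uniform rate.  By independence [P (M_n <= y) = F y ^ n].  If [y >= x0], put
[u = 1 - F y], a number in [0, 1]; then the test [gamma_n x >= - ln n] succeeds
because it says [n u <= n], so [B_n x = exp (- n u)], and the claim becomes the
elementary Poisson approximation [(1 - u)^n - exp (- n u) = O(1/n)], uniform in
[u] ([poisson_approx]).  If [y < x0], then [B_n x = 0] and
[F y ^ n <= F x0 ^ n] decays geometrically since [F x0 < 1].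

Pointwise limit.  It suffices that [gamma_n x] tends to [x], and since [b_n]
tends to infinity this is a statement about [b -> +oo] ([cvg_gamma]).  The
condition [f' -> 0] makes [f] Lipschitz on half-lines with an arbitrarily small
constant, which gives [f b = o(b)], hence [a x + b -> +oo], and
[f t / f b -> 1] uniformly for [t] between [b] and [a x + b] (self-neglecting
property).  Therefore [a * h t -> 1] uniformly on that segment, whose length is
[a |x|], and the integral of [h t - h b] over it vanishes in the limit; the
quotient of the values of [c] tends to 1.

The representation with [1 / f] is the one with [g / f] for [g] constant equal
to 1, the integrability of [1 / f] being a consequence of the continuity
of [f]. *)

(** * Elementary inequalities *)

(** [n q^n <= 1 + q + ... + q^(n-1) <= 1 / (1 - q)], as [q^n] is the smallest
of these powers. *)
Lemma expr_le_invnat (R : realFieldType) (q : R) (n : nat) :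
  0 <= q < 1 -> (0 < n)%N -> q ^+ n <= (1 - q)^-1 / n%:R.
Proof.
move=> /andP[q0 q1] n0; have q1' : 0 < 1 - q by rewrite subr_gt0.
have sumq : q ^+ n * n%:R <= \sum_(i < n) q ^+ i.
  have -> : q ^+ n * n%:R = \sum_(i < n) q ^+ n.
    by rewrite sumr_const card_ord mulr_natr.
  apply: ler_sum => i _.
  by apply: ler_wiXn2l => //; [exact: ltW|exact/ltnW/ltn_ord].
rewrite ler_pdivlMr ?ltr0n// -[leRHS]mul1r ler_pdivlMr// mulrC.
apply: (le_trans (ler_wpM2l (ltW q1') sumq)).
have -> : (1 - q) * \sum_(i < n) q ^+ i = 1 - q ^+ n.
  by rewrite -opprB mulNr -subrX1 opprB.
by rewrite gerBl exprn_ge0.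
Qed.

Lemma subrXX_le (R : realFieldType) (p q : R) (n : nat) :
  0 <= q -> q <= p -> p ^+ n - q ^+ n <= n%:R * (p - q) * p ^+ n.-1.
Proof.
move=> q0 qp; have p0 := le_trans q0 qp.
rewrite subrXX -mulrA [leRHS]mulrCA ler_wpM2l ?subr_ge0//.
have -> : n%:R * p ^+ n.-1 = \sum_(i < n) p ^+ n.-1.
  by rewrite sumr_const card_ord mulr_natl.
apply: ler_sum => i _.
have -> : p ^+ n.-1 = p ^+ (n.-1 - i) * p ^+ i.
  by rewrite -exprD subnK// -ltnS prednK ?ltn_ord//; case: n i => [[]|].
by apply: ler_wpM2l; [exact: exprn_ge0|exact: lerXn2r].
Qed.

Lemma expRN_sub1_le (R : realType) (u : R) :
  0 <= u -> expR (- u) - (1 - u) <= u ^+ 2.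
Proof.
move=> u0; have u1 : 0 < 1 + u by rewrite ltr_pwDl.
have : expR (- u) <= (1 + u)^-1.
  by rewrite expRN lef_pV2 ?posrE ?expR_gt0// expR_ge1Dx.
suff : (1 + u)^-1 <= 1 - u + u ^+ 2 by lra.
rewrite -[leLHS]mul1r ler_pdivrMr//.
have -> : (1 - u + u ^+ 2) * (1 + u) = 1 + u ^+ 3 by ring.
by rewrite lerDl exprn_ge0.
Qed.

Lemma sqr_expRN_le (R : realType) (t : R) : 0 <= t -> t ^+ 2 * expR (- t) <= 4.
Proof.
move=> t0; rewrite expRN ler_pdivrMr ?expR_gt0//.
(* Halving [t] first makes the linear bound on [expR] a quadratic one. *)
have -> : expR t = expR (t / 2) ^+ 2 by rewrite -expRM_natl; congr expR; lra.
have h : 0 <= 1 + t / 2 <= expR (t / 2).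
  by rewrite expR_ge1Dx andbT; lra.
have : (1 + t / 2) ^+ 2 <= expR (t / 2) ^+ 2.
  by case/andP: h => h1 h2; apply: lerXn2r => //; rewrite nnegrE ?expR_ge0.
move=> h2; apply: (@le_trans _ _ (4 * (1 + t / 2) ^+ 2)); first by nra.
by rewrite ler_pM2l.
Qed.

(** Both sides are [n]-th powers, of [1 - u <= exp (- u)], bases that differ by
at most [u^2].  The mean value estimate [subrXX_le] bounds the difference by
[n u^2 exp (- (n - 1) u)], which is [(n u)^2 exp (- n u) exp u / n], and
[t^2 exp (- t)] is bounded. *)
Lemma poisson_approx (R : realType) (u : R) (n : nat) :
  0 <= u <= 1 -> (0 < n)%N ->
  `|(1 - u) ^+ n - expR (- (n%:R * u))| <= 4 * expR 1 / n%:R.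
Proof.
move=> /andP[u0 u1] n0; have n0' : 0 < n%:R :> R by rewrite ltr0n.
have E : expR (- (n%:R * u)) = expR (- u) ^+ n by rewrite -expRM_natl mulrN.
have le : 1 - u <= expR (- u) by exact: expR_ge1Dx.
have v0 : 0 <= 1 - u by rewrite subr_ge0.
rewrite distrC E ger0_norm; last first.
  by rewrite subr_ge0 lerXn2r ?nnegrE ?expR_ge0.
apply: (le_trans (subrXX_le n v0 le)).
have -> : expR (- u) ^+ n.-1 = expR (- (n%:R * u)) * expR u.
  rewrite E -{2}(prednK n0) exprSr -mulrA -expRD addNr expR0 mulr1//.
rewrite ler_pdivlMr// -!mulrA.
apply: (@le_trans _ _
  (n%:R * (u ^+ 2 * (expR (- (n%:R * u)) * (expR u * n%:R))))).
  rewrite ler_pM2l//; apply: ler_wpM2r; last exact: expRN_sub1_le.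
  by rewrite pmulr_rge0 ?expR_gt0// pmulr_rge0 ?expR_gt0// ltW.
have -> : n%:R * (u ^+ 2 * (expR (- (n%:R * u)) * (expR u * n%:R)))
        = (n%:R * u) ^+ 2 * expR (- (n%:R * u)) * expR u by ring.
apply: ler_pM; rewrite ?mulr_ge0 ?expR_ge0 ?sqr_ge0//; last by rewrite ler_expR.
by apply: sqr_expRN_le; apply: mulr_ge0 => //; exact: ltW.
Qed.

(** * Distribution of the maximum *)

Lemma prob_max_leE (d : measure_display) (T : measurableType d) (R : realType)
    (P : probability T R) (X : nat -> {RV P >-> R}) (F : R -> R) (n : nat)
    (y : R) :
  mutually_independent X -> (forall i x, cdf (X i) x = (F x)%:E) ->
  (0 < n)%N -> prob_max_le X n y = F y ^+ n.
Proof.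
move=> indep XF n0; rewrite /prob_max_le.
have -> : [set w | sample_max X n w <= y] =
    \bigcap_(i in [set` iota 0 n]) (X i @^-1` `]-oo, y]).
  apply/seteqP; split=> w /=.
    move=> /bigmax_leP[_ h] i /=; rewrite mem_iota /= add0n => ni.
    by rewrite in_itv /=; exact: (h (Ordinal ni)).
  move=> h; apply/bigmax_leP; split => [|i _].
    by have := h 0%N; rewrite /= mem_iota in_itv /=; exact.
  by have := h i; rewrite /= mem_iota in_itv /= add0n ltn_ord; exact.
rewrite indep ?iota_uniq//.
have H i : P (X i @^-1` `]-oo, y]) = (F y)%:E by exact: XF.
have -> : (\prod_(i <- iota 0 n) P (X i @^-1` `]-oo, y]) = (F y ^+ n)%:E)%E.
  rewrite -{2}(size_iota 0 n); elim: (iota 0 n) => [|i s IH].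
    by rewrite big_nil expr0.
  by rewrite big_cons H IH -EFinM -exprS.
by [].
Qed.

(** * The oriented integral *)

Section oriented_integral.
Context {R : realType}.
Notation mu := (@lebesgue_measure R).
Implicit Types (h : R -> R) (s t : R).

Lemma integrable_on_segmentsS (x0 : R) h s t : integrable_on_segments x0 h ->
  x0 <= s -> mu.-integrable `[s, t] (EFin \o h).
Proof.
move=> ih x0s; apply: (@integrableS _ _ _ mu `[x0, Num.max x0 t]) => //.
  by apply: subset_itv; rewrite bnd_simp// le_max lexx orbT.
by apply: ih; rewrite le_max lexx.
Qed.

Lemma oint_difference (x0 : R) h s t : integrable_on_segments x0 h ->
  x0 <= s -> x0 <= t -> oint h s t = oint h x0 t - oint h x0 s.
Proof.
move=> ih.
have H u v : x0 <= u -> u <= v ->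
    \int[mu]_(w in `[u, v]) h w = oint h x0 v - oint h x0 u.
  move=> x0u uv; rewrite /oint x0u (le_trans x0u uv).
  rewrite Rintegral_itvB ?bnd_simp//; last exact: integrable_on_segmentsS ih _.
  rewrite Rintegral_itv_obnd_cbnd//.
  apply: (@integrableS _ _ _ mu `[u, v]) => //.
    by apply: subset_itv; rewrite bnd_simp.
  exact: integrable_on_segmentsS ih _.
move=> x0s x0t; rewrite {1}/oint; case: leP => st; first exact: H.
by rewrite H ?opprB// ltW.
Qed.

Lemma Rintegral_itv_cst (k s t : R) : s <= t ->
  \int[mu]_(_ in `[s, t]) k = k * (t - s).
Proof.
move=> st; rewrite Rintegral_cst//; congr (_ * _).
transitivity (fine (lebesgue_measure (`[s, t]%classic : set R))) => //.
rewrite lebesgue_measure_itv/= lte_fin; case: ltP => ts //=.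
by have -> : t = s; [apply/le_anti/andP; split|rewrite subrr].
Qed.

Lemma integrable_itv_cst (k s t : R) :
  mu.-integrable `[s, t] (EFin \o (fun=> k)).
Proof.
apply: continuous_compact_integrable; first exact: segment_compact.
by apply: continuous_subspaceT => u; exact: cvg_cst.
Qed.

Lemma oint_center (x0 : R) h s t k : integrable_on_segments x0 h ->
  x0 <= s -> x0 <= t -> oint (fun u => h u - k) s t = oint h s t - k * (t - s).
Proof.
move=> ih x0s x0t; rewrite /oint.
have H u v : x0 <= u -> u <= v ->
    \int[mu]_(w in `[u, v]) (h w - k) =
    \int[mu]_(w in `[u, v]) h w - k * (v - u).
  move=> x0u uv; rewrite -Rintegral_itv_cst// RintegralB//.
    exact: integrable_on_segmentsS ih _.
  exact: integrable_itv_cst.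
case: leP => st; first exact: H.
by rewrite H ?(ltW st)//; ring.
Qed.

(** The bound on [h] is required on the segment between [s] and [t] only, in
whichever order they come: the sign of [x] in [a x + b] is arbitrary. *)
Lemma le_norm_oint (x0 : R) h s t M : integrable_on_segments x0 h ->
  x0 <= s -> x0 <= t ->
  (forall u, Num.min s t <= u <= Num.max s t -> `|h u| <= M) ->
  `|oint h s t| <= M * `|t - s|.
Proof.
move=> ih x0s x0t hM.
have H u v : x0 <= u -> u <= v -> Num.min s t <= u -> v <= Num.max s t ->
    `|\int[mu]_(w in `[u, v]) h w| <= M * (v - u).
  move=> x0u uv su vt; have ihuv := @integrable_on_segmentsS x0 h u v ih x0u.
  apply: (le_trans (le_normr_Rintegral _ ihuv)) => //.
  rewrite -Rintegral_itv_cst//; apply: le_Rintegral => //.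
  - have -> : EFin \o (fun w => `|h w|) = abse \o (EFin \o h) by [].
    exact: integrable_abse.
  - exact: integrable_itv_cst.
  - move=> w /=; rewrite in_itv /= => /andP[uw wv].
    by apply: hM; rewrite (le_trans su uw) (le_trans wv vt).
rewrite /oint; case: ifPn => [st|].
  rewrite (ger0_norm (_ : 0 <= t - s)) ?subr_ge0//.
  by apply: H => //; rewrite ?ge_min ?le_max lexx ?orbT.
rewrite -ltNge => /ltW ts.
rewrite normrN distrC (ger0_norm (_ : 0 <= s - t)) ?subr_ge0//.
by apply: H => //; rewrite ?ge_min ?le_max lexx ?orbT.
Qed.

End oriented_integral.

(** * Consequences of the tail representation *)

Lemma abs_cont_continuous (R : realType) (x0 x : R) (f f' : R -> R) :
  abs_cont_density x0 f f' -> x0 <= x -> {within `[x0, x], continuous f}.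
Proof.
move=> [if' fE] x0x.
have C := parameterized_integral_continuous x0x (if' x x0x).
apply: (@subspace_eq_continuous _ _ _
  (fun y => f x0 + parameterized_integral lebesgue_measure x0 y f')).
  move=> y /=; rewrite inE /= in_itv /= => /andP[x0y _].
  by rewrite [RHS]fE// /oint x0y.
by move=> y; apply: cvgD; [exact: cvg_cst|exact: C].
Qed.

Lemma integrable_on_segments_inv (R : realType) (x0 : R) (f f' : R -> R) :
  (forall x, x0 <= x -> 0 < f x) -> abs_cont_density x0 f f' ->
  integrable_on_segments x0 (fun t => 1 / f t).
Proof.
move=> f0 fac x x0x; apply: continuous_compact_integrable.
  exact: segment_compact.
apply: (@subspace_eq_continuous _ _ _ (fun t => (f t)^-1)).
  by move=> y _; rewrite /from_subspace/= div1r.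
have C := abs_cont_continuous fac x0x.
apply/subspace_continuousP => y /= xy.
move/subspace_continuousP: C => /(_ y xy) C.
apply: cvgV => //; move: xy; rewrite in_itv /= => /andP[x0y _].
by rewrite gt_eqF ?f0.
Qed.

(** The term [x] of [gamma_] is [h b] times the length of the segment from [b]
to [a x + b], and cancels the centering of the integrand; what remains is the
quotient of the representations at [a x + b] and at [b]. *)
Lemma tail_reprE (R : realType) (F : R -> R) (x0 : R) (c h : R -> R)
    (a b x : R) :
  (forall y, F y < 1) -> integrable_on_segments x0 h -> tail_repr F x0 c h ->
  x0 <= b -> x0 <= a * x + b -> h b * a = 1 ->
  expR (- gamma_ c h a b x) = (1 - F (a * x + b)) / (1 - F b).
Proof.
move=> F1 ih Fc x0b x0y ha; set y := a * x + b in x0y *.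
have c0 z : x0 <= z -> 0 < c z.
  move=> x0z; have := F1 z; rewrite -subr_gt0 Fc// pmulr_lgt0//.
  exact: expR_gt0.
rewrite /gamma_ -/y (oint_center _ ih)// (oint_difference ih)//.
have -> : h b * (y - b) = x by rewrite /y addrK mulrA ha mul1r.
set I := oint h x0; set r := ln _.
have -> : - (I y - I b - x - r + x) = I b - I y + r by ring.
rewrite !expRD expRN /r lnK ?posrE ?divr_gt0 ?c0// !Fc// -/(I y) -/(I b) !expRN.
by field; rewrite !gt_eqF ?expR_gt0 ?c0.
Qed.

(** A bound [b_n <= M] for arbitrarily large [n] would give
[1 / n = 1 - F (b_n) >= 1 - F M > 0]. *)
Lemma cvg_norm_b (R : realType) (F : cumulativeBounded (0 : R) (1 : R)) :
  (forall x, F x < 1) ->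
  (\forall n \near \oo, 1 - F (norm_b F n) = n%:R^-1) ->
  norm_b F n @[n --> \oo] --> +oo.
Proof.
move=> F1 bE; apply/cvgryPge => M.
have F1M : 0 < 1 - F M by rewrite subr_gt0.
near=> n.
rewrite leNgt; apply/negP => /ltW bM.
have : F (norm_b F n) <= F M by exact: cumulative_is_nondecreasing.
have : 1 - F (norm_b F n) = n%:R^-1 by near: n.
have : n%:R^-1 < 1 - F M.
  have : (1 - F M)^-1 < n%:R by near: n; exact: nbhs_infty_gtr.
  by move=> h; rewrite invf_plt ?posrE// (lt_trans _ h)// invr_gt0.
lra.
Unshelve. all: by end_near. Qed.

(** * Self-neglecting property of [f] and limit of [gamma_] *)

Section self_neglecting.
Context {R : realType}.
Variables (x0 : R) (f f' g : R -> R).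
Hypothesis f_gt0 : forall x, x0 <= x -> 0 < f x.
Hypothesis f_ac : abs_cont_density x0 f f'.
Hypothesis f'_to0 : f' x @[x --> +oo] --> (0 : R).
Hypothesis g_to1 : g x @[x --> +oo] --> (1 : R).

Lemma cvg_pinfty_threshold (u : R -> R) (l : R) : u x @[x --> +oo] --> l ->
  forall e, 0 < e -> exists M, forall x, M <= x -> `|u x - l| <= e.
Proof.
move=> /cvgrPdist_le ul e /ul [M [_ hM]]; exists (M + 1) => x Mx.
by rewrite distrC hM// (lt_le_trans _ Mx)// ltrDl.
Qed.

Lemma abs_cont_lipschitz e : 0 < e ->
  exists M, x0 <= M /\ forall s t, M <= s -> M <= t ->
    `|f t - f s| <= e * `|t - s|.
Proof.
move=> e0; have [M hM] := cvg_pinfty_threshold f'_to0 e0.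
have [if' fE] := f_ac.
exists (Num.max x0 M); split => [|s t]; first by rewrite le_max lexx.
rewrite !ge_max => /andP[x0s Ms] /andP[x0t Mt].
have -> : f t - f s = oint f' s t.
  by rewrite (oint_difference if')// [f t]fE// [f s]fE//; ring.
apply: (le_norm_oint if') => // u /andP[stu _]; rewrite -[f' u]subr0; apply: hM.
by rewrite (le_trans _ stu)// le_min Ms Mt.
Qed.

(** Beyond some [M] the function [f] grows with slope at most [e / 2]; the other
half of the slope absorbs the constant [f M - (e / 2) M]. *)
Lemma f_sublinear e : 0 < e -> \forall b \near +oo, f b <= e * b.
Proof.
move=> e0; have e2 : 0 < e / 2 by rewrite divr_gt0.
have [M [x0M hM]] := abs_cont_lipschitz e2.
near=> b.
have Mb : M <= b by near: b; exact/nbhs_pinfty_ge/num_real.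
have h := hM M b (lexx _) Mb.
rewrite (ger0_norm (_ : 0 <= b - M)) ?subr_ge0// in h.
have h1 := le_trans (ler_norm _) h.
have Cb : (f M - e / 2 * M) / (e / 2) <= b.
  by near: b; exact/nbhs_pinfty_ge/num_real.
rewrite ler_pdivrMr// in Cb.
lra.
Unshelve. all: by end_near. Qed.

(** The facts about the scale [a = f b / g b] that are used for every large [b].
The bound [g b >= 1/2] gives [a <= 2 f b]. *)
Lemma near_scale x : \forall b \near +oo,
  [/\ x0 <= b, 1 / 2 <= g b, 0 < f b / g b &
      `|f b / g b * x| <= 2 * `|x| * f b].
Proof.
have h0 : 0 < 1 / 2 :> R by rewrite divr_gt0.
have [M hM] := cvg_pinfty_threshold g_to1 h0.
near=> b.
have x0b : x0 <= b by near: b; exact/nbhs_pinfty_ge/num_real.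
have Mb : M <= b by near: b; exact/nbhs_pinfty_ge/num_real.
have gb : 1 / 2 <= g b.
  by have := hM b Mb; rewrite ler_distl => /andP[]; lra.
have g0 : 0 < g b by exact: lt_le_trans gb.
have fb := f_gt0 x0b.
split => //; first exact: divr_gt0.
rewrite normrM gtr0_norm ?divr_gt0// mulrAC ler_pdivrMr//.
have : 0 <= f b * `|x| by rewrite mulr_ge0// ltW.
nra.
Unshelve. all: by end_near. Qed.

Lemma cvg_affine_pinfty x : f b / g b * x + b @[b --> +oo] --> +oo.
Proof.
apply/cvgryPge => A.
have k0 : 0 < 4 * (`|x| + 1) by rewrite mulr_gt0// ltr_pwDr.
near=> b.
have [x0b gb ab abx] : [/\ x0 <= b, 1 / 2 <= g b, 0 < f b / g b &
   `|f b / g b * x| <= 2 * `|x| * f b] by near: b; exact: near_scale.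
have fb := f_gt0 x0b.
(* This makes the displacement [a x] at most [b / 2]. *)
have : f b <= (4 * (`|x| + 1))^-1 * b.
  by near: b; apply: f_sublinear; rewrite invr_gt0.
rewrite ler_pdivlMl// => h.
have A2 : 2 * A <= b by near: b; exact/nbhs_pinfty_ge/num_real.
have : - (f b / g b * x) <= `|f b / g b * x| by rewrite -normrN ler_norm.
lra.
Unshelve. all: by end_near. Qed.

(** A quantitative form of the continuity of [G / r / B] at [(1, 1, 1)].  It
serves with [G = g t], [B = g b] and [r = f t / f b], for which [G / r / B] is
[a * h t]. *)
Lemma ratio_dist (e G B r : R) : e <= 1 / 2 ->
  `|G - 1| <= e -> `|B - 1| <= e -> `|r - 1| <= e ->
  `|G / r / B - 1| <= 16 * e.
Proof.
move=> e2 Ge Be re.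
have e0 : 0 <= e by exact: le_trans (normr_ge0 _) Ge.
have B2 : 1 / 2 <= B by move: Be; rewrite ler_distl => /andP[]; lra.
have r2 : 1 / 2 <= r by move: re; rewrite ler_distl => /andP[]; lra.
have Br : 1 / 4 <= r * B by nra.
have Br0 : 0 < r * B by exact: lt_le_trans Br.
have -> : G / r / B - 1 = ((G - 1) - (B - 1) * r - (r - 1)) / (r * B).
  have B0 : 0 < B by exact: lt_le_trans B2.
  have r0 : 0 < r by exact: lt_le_trans r2.
  by field; rewrite !gt_eqF.
rewrite normrM normfV (gtr0_norm Br0) ler_pdivrMr//.
have r3 : `|r| <= 3 / 2.
  by move: re; rewrite !ler_norml => /andP[re1 re2]; apply/andP; split; lra.
have h1 : `|(B - 1) * r| <= e * (3 / 2) by rewrite normrM ler_pM.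
apply: (@le_trans _ _ (4 * e)); last by nra.
apply: (le_trans (ler_normB _ _)).
have := ler_normB (G - 1) ((B - 1) * r).
lra.
Qed.

(** On the segment between [b] and [a x + b] the integrand is at most
[16 eta / a] in absolute value, and the segment has length [a |x|]: the scale
[a] cancels and the integral is at most [16 eta |x|]. *)
Lemma cvg_oint_center x : integrable_on_segments x0 (fun t => g t / f t) ->
  oint (fun t => g t / f t - g b / f b) b (f b / g b * x + b) @[b --> +oo]
    --> (0 : R).
Proof.
move=> ih; apply/cvgrPdist_le => e e0.
have X0 : 0 < `|x| + 1 by rewrite ltr_pwDr.
pose eta := Num.min (1 / 2) (e / (16 * (`|x| + 1))).
have eta0 : 0 < eta.
  by rewrite lt_min; apply/andP; split; rewrite divr_gt0// mulr_gt0.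
have eta2 : eta <= 1 / 2 by rewrite ge_min lexx.
have etae : 16 * eta * (`|x| + 1) <= e.
  have : eta <= e / (16 * (`|x| + 1)) by rewrite ge_min lexx orbT.
  by rewrite ler_pdivlMr ?mulr_gt0// => h; rewrite mulrAC mulrC.
have [G hG] := cvg_pinfty_threshold g_to1 eta0.
(* The segment has length at most [2 |x| f b], so this Lipschitz constant makes
   [f] vary by at most [eta * f b] along it. *)
have d0 : 0 < eta / (2 * (`|x| + 1)) by rewrite divr_gt0// mulr_gt0.
have [L [x0L hL]] := abs_cont_lipschitz d0.
near=> b.
have [x0b gb ab abx] : [/\ x0 <= b, 1 / 2 <= g b, 0 < f b / g b &
   `|f b / g b * x| <= 2 * `|x| * f b] by near: b; exact: near_scale.
have Gb : G <= b by near: b; exact/nbhs_pinfty_ge/num_real.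
have Lb : L <= b by near: b; exact/nbhs_pinfty_ge/num_real.
have Gy : G <= f b / g b * x + b.
  by near: b; move/cvgryPge: (@cvg_affine_pinfty x); exact.
have Ly : L <= f b / g b * x + b.
  by near: b; move/cvgryPge: (@cvg_affine_pinfty x); exact.
set y := f b / g b * x + b in Gy Ly *.
have x0y := le_trans x0L Ly.
have fb := f_gt0 x0b.
have near_b u : Num.min b y <= u <= Num.max b y -> `|f u / f b - 1| <= eta.
  move=> /andP[bu ub].
  have Lu : L <= u by rewrite (le_trans _ bu)// le_min Lb Ly.
  have -> : f u / f b - 1 = (f u - f b) / f b by rewrite mulrBl divff ?gt_eqF.
  rewrite normrM normfV (gtr0_norm fb) ler_pdivrMr//.
  apply: (le_trans (hL b u Lb Lu)).
  have uby : `|u - b| <= 2 * `|x| * f b.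
    apply: le_trans abx; have -> : f b / g b * x = y - b by rewrite /y addrK.
    by move: bu ub; case: (leP b y) => ? ? ?;
      [rewrite !ger0_norm|rewrite !ler0_norm]; lra.
  rewrite mulrAC ler_pdivrMr ?mulr_gt0// -mulrA ler_pM2l//.
  by apply: (le_trans uby); nra.
have close u : Num.min b y <= u <= Num.max b y ->
    `|g u / f u - g b / f b| <= 16 * eta / (f b / g b).
  move=> ubb; have /andP[bu _] := ubb.
  have Lu : L <= u by rewrite (le_trans _ bu)// le_min Lb Ly.
  have Gu : G <= u by rewrite (le_trans _ bu)// le_min Gb Gy.
  have fu := f_gt0 (le_trans x0L Lu).
  have gb0 : 0 < g b by lra.
  have -> : g u / f u - g b / f b = (g u / (f u / f b) / g b - 1) / (f b / g b).
    by field; rewrite !gt_eqF.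
  rewrite normrM normfV (gtr0_norm ab) ler_pM2r ?invr_gt0//.
  by apply: ratio_dist; rewrite ?hG// near_b.
have ihc : integrable_on_segments x0 (fun t => g t / f t - g b / f b).
  by move=> v x0v; exact: integrableB (ih v x0v) (integrable_itv_cst _ _ _).
rewrite sub0r normrN.
apply: (le_trans (le_norm_oint ihc x0b x0y close)).
have -> : y - b = f b / g b * x by rewrite /y addrK.
rewrite normrM (gtr0_norm ab) mulrA divfK ?gt_eqF//.
apply: le_trans etae; rewrite ler_pM2l ?mulr_gt0//.
by rewrite lerDl.
Unshelve. all: by end_near. Qed.

Lemma cvg_gamma (c : R -> R) (cinf x : R) :
  integrable_on_segments x0 (fun t => g t / f t) ->
  0 < cinf -> c y @[y --> +oo] --> cinf ->
  gamma_ c (fun t => g t / f t) (f b / g b) b x @[b --> +oo] --> x.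
Proof.
move=> ih cinf0 ccinf.
have C2 : c (f b / g b * x + b) / c b @[b --> +oo] --> (1 : R).
  rewrite -(divff (lt0r_neq0 cinf0)); apply: cvgM.
    by apply: cvg_comp ccinf; exact: cvg_affine_pinfty.
  by apply: cvgV => //; exact: lt0r_neq0.
have C3 : ln (c (f b / g b * x + b) / c b) @[b --> +oo] --> (0 : R).
  rewrite -ln1; apply: (@cvg_comp _ _ _ _ (@ln R) _ _ _ C2).
  exact: continuous_ln.
rewrite -[X in _ --> X]add0r -[X in _ --> X + _]subr0.
apply: cvgD; last exact: cvg_cst.
by apply: cvgB => //; exact: cvg_oint_center.
Qed.

End self_neglecting.

(** * Rate and limit *)

(** The cutoff [- ln n <= gamma_n x] is automatic above [x0], because it amounts
to [1 - F y <= 1]. *)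
Lemma B_tailE (R : realType) (F : R -> R) (x0 : R) (c h : R -> R) (a b : R)
    (n : nat) (x : R) :
  (forall y, 0 <= F y) -> (forall y, F y < 1) ->
  integrable_on_segments x0 h -> tail_repr F x0 c h ->
  x0 <= b -> x0 <= a * x + b -> h b * a = 1 -> 1 - F b = n%:R^-1 ->
  B_ x0 c h a b n x = expR (- expR (- gamma_ c h a b x)) /\
  expR (- gamma_ c h a b x) = n%:R * (1 - F (a * x + b)).
Proof.
move=> F0 F1 ih Fc x0b x0y ha Fb.
have gE : expR (- gamma_ c h a b x) = n%:R * (1 - F (a * x + b)).
  by rewrite (tail_reprE F1 ih Fc)// Fb invrK mulrC.
have n0 : 0 < n%:R :> R by rewrite -invr_gt0 -Fb subr_gt0.
split => //; rewrite /B_ ltNge x0y /= ifT//.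
rewrite lerNl -ler_expR lnK ?posrE// gE.
by apply: ler_piMr; [exact: ltW|rewrite gerBl].
Qed.

Lemma gumbel_rate (R : realType) (d : measure_display) (T : measurableType d)
    (P : probability T R) (X : nat -> {RV P >-> R})
    (F : cumulativeBounded (0 : R) (1 : R)) (x0 : R) (f f' g c : R -> R)
    (cinf : R) :
  mutually_independent X -> (forall i x, cdf (X i) x = (F x)%:E) ->
  (forall x, F x < 1) ->
  (forall x, x0 <= x -> 0 < f x) -> abs_cont_density x0 f f' ->
  f' x @[x --> +oo] --> (0 : R) -> g x @[x --> +oo] --> (1 : R) ->
  0 < cinf -> c x @[x --> +oo] --> cinf ->
  (\forall n \near \oo, 1 - F (norm_b F n) = n%:R^-1) ->
  let h t := g t / f t in
  integrable_on_segments x0 h -> tail_repr F x0 c h ->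
  let b n := norm_b F n in
  let a n := f (b n) / g (b n) in
  let B n x := B_ x0 c h (a n) (b n) n x in
  (exists K : R, \forall n \near \oo, forall x : R,
     `|prob_max_le X n (a n * x + b n) - B n x| <= K / n%:R) /\
  (forall x : R, B n x @[n --> \oo] --> Gumbel x).
Proof.
move=> indep XF F1 f0 fac f'0 g1 cinf0 ccinf bE h ih Fc b a B.
have b_pinfty : b n @[n --> \oo] --> +oo by exact: cvg_norm_b.
have F0 y : 0 <= F y by rewrite -lee_fin -(XF 0%N).
have scale := b_pinfty _ (near_scale f0 g1 0).
have regular : \forall n \near \oo,
    [/\ (0 < n)%N, x0 <= b n, h (b n) * a n = 1 & 1 - F (b n) = n%:R^-1].
  near=> n; split; first by near: n; exact: nbhs_infty_gt.
  - by near: n; move/cvgryPge: b_pinfty; exact.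
  - have [x0b gb _ _] : [/\ x0 <= b n, 1 / 2 <= g (b n), 0 < f (b n) / g (b n)
        & `|f (b n) / g (b n) * 0| <= 2 * `|0 : R| * f (b n)].
      by near: n; exact: scale.
    have fb := f0 _ x0b.
    have gb0 : 0 < g (b n) by lra.
    by rewrite /h /a; field; rewrite !gt_eqF.
  - by near: n.
split.
  (* One summand for each of the cases [y >= x0] and [y < x0]. *)
  exists (4 * expR 1 + (1 - F x0)^-1).
  near=> n => x.
  have [n0 x0b ha Fb] : [/\ (0 < n)%N, x0 <= b n, h (b n) * a n = 1
      & 1 - F (b n) = n%:R^-1] by near: n.
  rewrite (prob_max_leE _ indep XF n0).
  have i0 : 0 <= (1 - F x0)^-1 by rewrite invr_ge0 subr_ge0 ltW.
  have e0 : 0 <= 4 * expR 1 :> R by rewrite mulr_ge0 ?expR_ge0.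
  have n0' : 0 <= n%:R^-1 :> R by rewrite invr_ge0.
  have [x0y|yx0] := leP x0 (a n * x + b n).
    rewrite /B; have [-> ->] := B_tailE F0 F1 ih Fc x0b x0y ha Fb.
    have u01 : 0 <= 1 - F (a n * x + b n) <= 1.
      by rewrite subr_ge0 ltW// gerBl F0.
    have := poisson_approx u01 n0; rewrite subKr => /le_trans; apply.
    by rewrite ler_wpM2r// lerDl.
  rewrite /B /B_ yx0 subr0 ger0_norm ?exprn_ge0//.
  apply: (@le_trans _ _ (F x0 ^+ n)).
    apply: lerXn2r; rewrite ?nnegrE//.
    exact/cumulative_is_nondecreasing/ltW.
  apply: (le_trans (expr_le_invnat _ n0)); first by rewrite F0 F1.
  by rewrite ler_wpM2r// lerDr.
move=> x.
have gx : gamma_ c h (a n) (b n) x @[n --> \oo] --> x.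
  have := cvg_gamma f0 fac f'0 g1 (x := x) ih cinf0 ccinf.
  exact: (@cvg_comp _ _ _ b (fun v => gamma_ c h (f v / g v) v x)
    _ _ _ b_pinfty).
have G : expR (- expR (- gamma_ c h (a n) (b n) x)) @[n --> \oo] --> Gumbel x.
  apply: continuous_cvg; first exact: continuous_expR.
  apply: cvgN; apply: continuous_cvg; first exact: continuous_expR.
  exact: cvgN.
apply: cvg_trans G; apply: near_eq_cvg.
have yy : a n * x + b n @[n --> \oo] --> +oo.
  have := cvg_affine_pinfty f0 fac f'0 g1 x.
  exact: (@cvg_comp _ _ _ b (fun v => f v / g v * x + v) _ _ _ b_pinfty).
near=> n.
have [n0 x0b ha Fb] : [/\ (0 < n)%N, x0 <= b n, h (b n) * a n = 1
    & 1 - F (b n) = n%:R^-1] by near: n.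
have x0y : x0 <= a n * x + b n by near: n; move/cvgryPge: yy; exact.
by rewrite /B; have [-> _] := B_tailE F0 F1 ih Fc x0b x0y ha Fb.
Unshelve. all: by end_near. Qed.

Theorem theorem2 (R : realType) (d : measure_display) (T : measurableType d)
    (P : probability T R) (X : nat -> {RV P >-> R})
    (F : cumulativeBounded (0 : R) (1 : R))
    (X_indep : mutually_independent X)
    (X_cdf : forall (i : nat) (x : R), cdf (X i) x = (F x)%:E)
    (F_lt1 : forall x : R, F x < 1)
    (x0 : R) (x0_ge0 : 0 <= x0)
    (f f' c : R -> R) (cinf : R)
    (f_gt0 : forall x : R, x0 <= x -> 0 < f x)
    (f_ac : abs_cont_density x0 f f')
    (f'_to0 : f' x @[x --> +oo] --> (0 : R))
    (cinf_gt0 : 0 < cinf)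
    (c_lim : c x @[x --> +oo] --> cinf)
    (b_eq : \forall n \near \oo, 1 - F (norm_b F n) = n%:R^-1) :
  (tail_repr F x0 c (fun t => 1 / f t) ->
   let b n := norm_b F n in
   let a n := f (b n) in
   let B n x := B_ x0 c (fun t => 1 / f t) (a n) (b n) n x in
   (exists K : R, \forall n \near \oo, forall x : R,
      `|prob_max_le X n (a n * x + b n) - B n x| <= K / n%:R) /\
   (forall x : R, B n x @[n --> \oo] --> Gumbel x))
  /\
  (forall g : R -> R,
   g x @[x --> +oo] --> (1 : R) ->
   integrable_on_segments x0 (fun t => g t / f t) ->
   tail_repr F x0 c (fun t => g t / f t) ->
   let b n := norm_b F n in
   let a n := f (b n) / g (b n) in
   let B n x := B_ x0 c (fun t => g t / f t) (a n) (b n) n x in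
   (exists K : R, \forall n \near \oo, forall x : R,
      `|prob_max_le X n (a n * x + b n) - B n x| <= K / n%:R) /\
   (forall x : R, B n x @[n --> \oo] --> Gumbel x)).
Proof.
split => [Fc b a B|g g1 ih Fc].
  have aE : a = fun n => f (b n) / 1 by apply/funext => n; rewrite divr1.
  rewrite /B aE.
  exact: (gumbel_rate X_indep X_cdf F_lt1 f_gt0 f_ac f'_to0
    (g := fun=> 1) (cvg_cst _) cinf_gt0 c_lim b_eq
    (integrable_on_segments_inv f_gt0 f_ac) Fc).
exact: (gumbel_rate X_indep X_cdf F_lt1 f_gt0 f_ac f'_to0 g1 cinf_gt0 c_lim b_eq
  ih Fc).
Qed.
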